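(* Let $h$ and $k$ be positive integers such that $3 \leq h \leq k-1$ and $k \geq 5$. Let $A$ be a set of $k$ integers such that $A \cap (-A) = \{0\}$. If \[ |h^{\wedge}_{\pm}A| = 2hk - h(h+1) + 1, \] then, letting $d$ be the smallest nonzero element of $A_{abs}$, we have $A_{abs} = d\ast[0,4]$ or $A_{abs} = d \ast\{0,1,2,4,6\}$ if $h=4$ and $k=5$, and $A_{abs} = d\ast[0,k-1]$ otherwise.
   Context: For a finite set $A=\{a_1,\ldots,a_k\}$ of integers and a positive integer $h$, the restricted $h$-fold signed sumset is $h^{\wedge}_{\pm}A=\left\{\sum_{i=1}^{k}\lambda_i a_i : \lambda_i\in\{-1,0,1\} \text{ for all } i,\ \sum_{i=1}^{k}|\lambda_i| = h\right\}$. $-A=\{-a:a\in A\}$, $A_{abs}=\{|a| : a\in A\}$. For integers $a\le b$, $[a,b]=\{n\in\mathbb{Z}: a\le n\le b\}$; for an integer $c$ and a set $S$ of integers, $c\ast S=\{cs: s\in S\}$. *)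

(* Defs.v *)
From mathcomp Require Import all_boot all_order all_algebra finmap.

Set Implicit Arguments.
Unset Strict Implicit.
Unset Printing Implicit Defensive.

Import Order.TTheory GRing.Theory Num.Theory.

Local Open Scope fset_scope.
Local Open Scope ring_scope.

Definition signs : {fset int} := [fset -1; 0; 1].

(* The coefficient families (lambda_a)_{a \in A} are the finite functions from
   the elements of A to the elements of [signs]. *)
Definition restricted_signed_sumset (h : nat) (A : {fset int}) : {fset int} :=
  [fset \sum_(a : A) val (lam a) * val a | lam : {ffun A -> signs} in
     [pred lam : {ffun A -> signs} | \sum_(a : A) `|val (lam a)| == h%:Z]].

Definition opp_set (A : {fset int}) : {fset int} := [fset - a | a in A].

Definition abs_set (A : {fset int}) : {fset int} := [fset `|a| | a in A].

Definition dilate (c : int) (S : {fset int}) : {fset int} :=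
  [fset c * s | s in S].

Definition int_interval (a b : int) : {fset int} :=
  if a <= b then [fset a + i%:Z | i in iota 0 `|b - a|%N.+1] else fset0.

Definition is_smallest_nonzero (d : int) (S : {fset int}) : Prop :=
  [/\ d \in S, d != 0 & forall x, x \in S -> x != 0 -> d <= x].

Lemma mem_int_interval (a b n : int) :
  (n \in int_interval a b) = (a <= n <= b).
Proof.
rewrite /int_interval; case: ifP => [le_ab | /negP nle_ab]; last first.
  rewrite inE; apply/esym/negP => /andP[le_an le_nb].
  exact/nle_ab/(le_trans le_an).
have ba_ge0 : 0 <= b - a by rewrite subr_ge0.
apply/imfsetP/andP => [[i] | [le_an le_nb]].
  rewrite -[in_mem _ _]/(i \in iota 0 _) mem_iota add0n ltnS.
  move=> /andP[_ le_i] ->.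
  rewrite lerDl; split=> //; rewrite -lerBrDl -(gez0_abs ba_ge0).
  by rewrite lez_nat.
have na_ge0 : 0 <= n - a by rewrite subr_ge0.
exists `|n - a|%N; last by rewrite gez0_abs // -[RHS]addrC subrK.
rewrite -[in_mem _ _]/(_ \in iota 0 _) mem_iota add0n ltnS /= -lez_nat !gez0_abs //.
by rewrite lerD2r.
Qed.

Lemma restricted_signed_sumsetP (h : nat) (A : {fset int}) (n : int) :
  n \in restricted_signed_sumset h A <->
  exists lam : int -> int,
    [/\ forall a, a \in A -> lam a \in signs,
        \sum_(a <- A) `|lam a| = h%:Z & n = \sum_(a <- A) lam a * a].
Proof.
split=> [/imfsetP[lam /= /eqP Hlam ->] | [lam [lamP Hlam ->]]].
  pose f (x : int) : int := if insub x is Some a then val (lam a) else 0.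
  have fE (a : A) : f (val a) = val (lam a) by rewrite /f valK.
  exists f; split; last 2 first.
  - by rewrite big_seq_fsetE /= -Hlam; apply: eq_bigr => a _; rewrite fE.
  - by rewrite big_seq_fsetE /=; apply: eq_bigr => a _; rewrite fE.
  by move=> a aA; rewrite (fE [` aA]) (valP (lam [` aA])).
apply/imfsetP; exists [ffun a : A => [` lamP _ (valP a)]] => /=.
  apply/eqP; rewrite -Hlam big_seq_fsetE.
  by apply: eq_bigr => a _; rewrite ffunE.
by rewrite big_seq_fsetE; apply: eq_bigr => a _; rewrite ffunE.
Qed.

(* Main.v *)
Require Import Defs.
From mathcomp Require Import all_boot all_order all_algebra finmap zify.

(* The sumset depends only on [A_abs], the union of {0} and a set B of n = k - 1
   positive integers.

   If h < n, remove the largest element b of B.  Writing t for the sum of the h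
   largest remaining elements, the numbers b + t - x, for x among these h
   elements, exceed every sum that avoids b, so with their opposites they
   contribute 2h new sums.  This is exactly the growth of the extremal
   cardinality, hence B without b is extremal as well; one further new sum shows
   that b continues the progression.

   If h = n, subtracting every sum from the sum of B turns the sumset into the
   set U(B) of the sums of elements of B with coefficients 0, 1, 2 and at most
   one coefficient 1.  For n >= 3 at least 2n elements of U(B) are below 2b:
   after dividing by a power of 2 some element c of B is odd, and 0, the elements
   of B, and one of b + 2x, c + 2x, 2x for each x in B are distinct by parity, up
   to one missing element.  Reflecting them in the sum of B gives
   |U(B)| >= |U(B \ b)| + 2n, so extremality again descends, down to n = 2 where
   B = {d, 2d}.  Going back up, B is d {1, ..., n}, except that d {1, 2, 4} and
   d {1, 2, 4, 6} also occur, and the latter does not extend. *)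

Set Implicit Arguments.
Unset Strict Implicit.
Unset Printing Implicit Defensive.

Import Order.TTheory GRing.Theory Num.Theory.
Local Open Scope fset_scope.
Local Open Scope ring_scope.

(** * Sums with coefficients 0, 1, 2 *)

Definition scale (d : int) (s : seq int) : seq int := [seq d * x | x <- s].

Definition distinct (s : seq int) : nat := size (undup s).

Definition list_sum (s : seq int) : int := foldr +%R 0 s.

Arguments list_sum : simpl never.

Lemma list_sum_cons (a : int) (s : seq int) : list_sum (a :: s) = a + list_sum s.
Proof. by []. Qed.

Fixpoint even_sums (s : seq int) : seq int :=
  if s is a :: s' then even_sums s' ++ [seq 2 * a + x | x <- even_sums s']
  else [:: 0].

(* Sums with coefficients 0, 1 and 2, at most one of them being 1.  These are
   the numbers [list_sum s - x], for [x] a sum of the elements of [s] with signs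
   of which at most one is 0: see [signed_sums_near]. *)
Fixpoint near_even_sums (s : seq int) : seq int :=
  if s is a :: s' then
    near_even_sums s' ++ [seq 2 * a + x | x <- near_even_sums s']
      ++ [seq a + x | x <- even_sums s']
  else [:: 0].

Lemma mem_shift (a x : int) (s : seq int) :
  (x \in [seq a + y | y <- s]) = (x - a \in s).
Proof.
apply/mapP/idP => [[y ys ->]|xs]; first by rewrite addrC addKr.
by exists (x - a); rewrite // addrC subrK.
Qed.

Lemma mem_even_sums_cons (a x : int) (s : seq int) :
  (x \in even_sums (a :: s)) = (x \in even_sums s) || (x - 2 * a \in even_sums s).
Proof. by rewrite /= mem_cat mem_shift. Qed.

Lemma mem_near_even_sums_cons (a x : int) (s : seq int) :
  (x \in near_even_sums (a :: s)) =
  [|| x \in near_even_sums s, x - 2 * a \in near_even_sums s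
    | x - a \in even_sums s].
Proof. by rewrite /= !mem_cat !mem_shift. Qed.

Lemma even_sums0 (s : seq int) : 0 \in even_sums s.
Proof. by elim: s => //= a s IH; rewrite mem_cat IH. Qed.

Lemma even_sums_near (s : seq int) : {subset even_sums s <= near_even_sums s}.
Proof.
elim: s => // a s IH x; rewrite mem_even_sums_cons mem_near_even_sums_cons.
by case/orP => [/IH ->|/IH ->]; rewrite ?orbT.
Qed.

Lemma even_sums1 (s : seq int) (x : int) : x \in s -> 2 * x \in even_sums s.
Proof.
elim: s => // a s IH; rewrite in_cons mem_even_sums_cons => /orP[/eqP-> | /IH -> //].
by rewrite subrr even_sums0 orbT.
Qed.

Lemma even_sums2 (s : seq int) (x y : int) :
  x \in s -> y \in s -> x != y -> 2 * x + 2 * y \in even_sums s.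
Proof.
elim: s => // a s IH; rewrite !in_cons mem_even_sums_cons.
case/orP => [/eqP-> | xs]; case/orP => [/eqP-> | ys]; rewrite ?eqxx // => xy.
- by rewrite [_ + _ - _]addrC addKr (even_sums1 ys) ?orbT.
- by rewrite addrK (even_sums1 xs) orbT.
- by rewrite IH.
Qed.

Lemma near_even_sums1 (s : seq int) (x : int) : x \in s -> x \in near_even_sums s.
Proof.
elim: s => // a s IH; rewrite in_cons mem_near_even_sums_cons.
by case/orP => [/eqP-> | /IH -> //]; rewrite subrr even_sums0 !orbT.
Qed.

Lemma near_even_sums2 (s : seq int) (x y : int) :
  x \in s -> y \in s -> x != y -> x + 2 * y \in near_even_sums s.
Proof.
elim: s => // a s IH; rewrite !in_cons mem_near_even_sums_cons.
case/orP => [/eqP-> | xs]; case/orP => [/eqP-> | ys]; rewrite ?eqxx // => xy.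
- by rewrite [_ + _ - a]addrC addKr (even_sums1 ys) ?orbT.
- by rewrite addrK (near_even_sums1 xs) orbT.
- by rewrite IH.
Qed.

Lemma even_sums_scale (q : int) (s : seq int) :
  even_sums (scale q s) = scale q (even_sums s).
Proof.
elim: s => [|a s /= ->]; first by rewrite /= mulr0.
rewrite /scale map_cat -!map_comp; congr (_ ++ _); apply: eq_map => x /=.
by rewrite mulrDr mulrCA.
Qed.

Lemma near_even_sums_scale (q : int) (s : seq int) :
  near_even_sums (scale q s) = scale q (near_even_sums s).
Proof.
elim: s => [|a s /= ->]; first by rewrite /= mulr0.
rewrite even_sums_scale /scale !map_cat -!map_comp; congr (_ ++ (_ ++ _)).
  by apply: eq_map => x /=; rewrite mulrDr mulrCA.
by apply: eq_map => x /=; rewrite mulrDr.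
Qed.

Lemma even_sums_sym (s : seq int) (x : int) :
  (2 * list_sum s - x \in even_sums s) = (x \in even_sums s).
Proof.
elim: s x => [|a s IH] x; first by rewrite /list_sum /= !inE; lia.
rewrite list_sum_cons !mem_even_sums_cons -(IH x) -(IH (x - _)) orbC.
by congr (_ || _); congr (in_mem _ _); lia.
Qed.

(** Replacing each coefficient [e] by [2 - e] fixes the coefficient 1, so at most one coefficient
    still equals 1. *)
Lemma near_even_sums_sym (s : seq int) (x : int) :
  (2 * list_sum s - x \in near_even_sums s) = (x \in near_even_sums s).
Proof.
elim: s x => [|a s IH] x; first by rewrite /list_sum /= !inE; lia.
rewrite list_sum_cons !mem_near_even_sums_cons -(IH x) -(IH (x - _)) -(even_sums_sym _ (x - _)).
rewrite orbCA; congr [|| _, _ | _]; congr (in_mem _ _); lia.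
Qed.

Lemma near_even_sums_le (s : seq int) (x : int) :
  {in s, forall y : int, 0 < y} -> x \in near_even_sums s -> x <= 2 * list_sum s.
Proof.
move=> s_gt0.
(* By the symmetry the upper bound follows from nonnegativity, proved jointly for both kinds of sums
   because of the recursion. *)
suff sE (y : int) :
    (y \in near_even_sums s -> 0 <= y) /\ (y \in even_sums s -> 0 <= y).
  by rewrite -near_even_sums_sym => /(proj1 (sE _)); lia.
elim: s s_gt0 y => [|a s IH] s_gt0 y; first by rewrite /= !inE; split=> /eqP->.
have a_gt0 := s_gt0 a (mem_head _ _).
have {}IH z := IH (fun w ws => s_gt0 w (@mem_behead _ (a :: s) w ws)) z.
rewrite mem_near_even_sums_cons mem_even_sums_cons; split.
  by case/or3P => [/(proj1 (IH _)) | /(proj1 (IH _)) | /(proj2 (IH _))]; lia.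
by case/orP => /(proj2 (IH _)); lia.
Qed.

Arguments scale : simpl never.
Arguments even_sums : simpl never.
Arguments near_even_sums : simpl never.

Lemma leq_distinct (L s : seq int) :
  uniq L -> {subset L <= s} -> (size L <= distinct s)%N.
Proof. by move=> L_uniq Ls; apply: uniq_leq_size => // x /Ls; rewrite mem_undup. Qed.

Lemma distinct_scale (d : int) (s : seq int) :
  d != 0 -> distinct (scale d s) = distinct s.
Proof. by move=> d0; rewrite /distinct undup_map_inj ?size_map //; apply: mulfI. Qed.

Lemma mem_scale (d x : int) (s : seq int) : x \in s -> d * x \in scale d s.
Proof. exact: map_f. Qed.

(* The elements of [L] lie below [2 * b], so their reflections in
   [list_sum (b :: s)] lie above the largest element of [near_even_sums s]. *)
Lemma near_even_sums_window (b : int) (s L : seq int) :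
  {in s, forall y : int, 0 < y} -> uniq L ->
  {in L, forall x : int, x \in near_even_sums (b :: s) /\ x < 2 * b} ->
  (distinct (near_even_sums s) + size L <= distinct (near_even_sums (b :: s)))%N.
Proof.
move=> s_gt0 L_uniq Lw.
rewrite -(size_map (fun x => 2 * list_sum (b :: s) - x) L) -size_cat.
apply: leq_distinct.
  rewrite cat_uniq undup_uniq map_inj_uniq ?L_uniq ?andbT /=; last by move=> ? ? /=; lia.
  apply/hasPn => _ /mapP[x /Lw[_ xb] ->]; rewrite mem_undup; apply/negP.
  by move/(near_even_sums_le s_gt0); rewrite list_sum_cons; lia.
move=> x; rewrite mem_cat mem_undup => /orP[xs | /mapP[y /Lw[ys _] ->]].
  by rewrite mem_near_even_sums_cons xs.
by rewrite near_even_sums_sym.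
Qed.

(** * Elements below twice the maximum *)

Definition odd_int (x : int) : Prop := exists q, x = 2 * q + 1.

Lemma even_or_odd (x : int) : (exists q, x = 2 * q) \/ odd_int x.
Proof.
have := divz_eq x 2; have := ltz_pmod x (d := 2) isT; have := modz_ge0 x (d := 2) isT.
move=> r0 r2 xE; have [r|r] : (x %% 2)%Z = 0 \/ (x %% 2)%Z = 1 by lia.
  by left; exists (x %/ 2)%Z; lia.
by right; exists (x %/ 2)%Z; lia.
Qed.

(* For [c] odd and [b] even, [window_elt b c] is injective: its values of the
   form [c + 2 * x] are odd, while among the even ones those of the form
   [b + 2 * x] are below [2 * b - c] and those of the form [2 * x] above. *)
Definition window_elt (b c x : int) : int :=
  if c + 2 * x < b then b + 2 * x else if c + 2 * x < 2 * b then c + 2 * x else 2 * x.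

(* With [b = 2 * m], the hypothesis [tight] says that each odd [c] in [s] yields,
   through [window_elt], all the elements of [near_even_sums (b :: s)] below
   [2 * b].  Applied to [2 * c] or to [b + 2 * c] it gives [b < 3 * c < 2 * b]
   and, unless [c = m], puts [c + m] or [c - m] in [s]; the other steps apply it to elements
   [x + 2 * y] until an infinite descent or ascent inside [s] appears. *)
Lemma tight_window_absurd (m c0 : int) (s : seq int) :
  uniq s -> (2 <= size s)%N -> {in s, forall x : int, 0 < x < 2 * m} ->
  c0 \in s -> odd_int c0 ->
  (forall c z : int, c \in s -> odd_int c -> z \in near_even_sums (2 * m :: s) ->
     z < 4 * m ->
     [\/ z = 0, z \in 2 * m :: s
       | exists2 x, x \in s & x != c /\ z = window_elt (2 * m) c x]) ->
  False.
Proof.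
move=> s_uniq s_size s_lt c0s c0_odd tight.
(* All values of [window_elt] are at least [2 * m], so below [2 * m] only elements of [s] remain. *)
have low c z : c \in s -> odd_int c -> z \in near_even_sums (2 * m :: s) ->
    0 < z < 2 * m -> z \in s.
  move=> cs c_odd zn zlt; have zlt4 : z < 4 * m by lia.
  have c_lt := s_lt c cs.
  case: (tight c z cs c_odd zn zlt4) => [z0 | | [x xs [_ ]]].
  - by move: zlt; rewrite z0; lia.
  - by rewrite in_cons => /orP[/eqP zE | //]; move: zlt; rewrite zE; lia.
  - have x_lt := s_lt x xs.
    by rewrite /window_elt; case: ifP => h1; [| case: ifP => h2]; lia.
(* Above [2 * m] only values of [window_elt] remain. As [c + 2 * x] is odd, its comparisons with
   [2 * m] and [4 * m] are strict. *)
have high c z : c \in s -> odd_int c -> z \in near_even_sums (2 * m :: s) ->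
    2 * m < z < 4 * m ->
    exists2 x, x \in s & x != c /\
      [\/ c + 2 * x < 2 * m /\ z = 2 * m + 2 * x,
          2 * m < c + 2 * x < 4 * m /\ z = c + 2 * x
        | 4 * m < c + 2 * x /\ z = 2 * x].
  move=> cs c_odd zn zlt; have zlt4 : z < 4 * m by lia.
  case: (tight c z cs c_odd zn zlt4) => [z0 | | [x xs [xc zE]]].
  - by move: zlt; rewrite z0; lia.
  - rewrite in_cons => /orP[/eqP zE | /s_lt]; last by lia.
    by move: zlt; rewrite zE; lia.
  - exists x => //; split=> //; move: zE; have [q ->] := c_odd.
    rewrite /window_elt; case: ifP => h1; first by move=> zE; apply: Or31; lia.
    case: ifP => h2; first by move=> zE; apply: Or32; lia.
    by move=> zE; apply: Or33; lia.
have near2 x : x \in s -> 2 * x \in near_even_sums (2 * m :: s).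
  by move=> xs; apply/even_sums_near/even_sums1; rewrite in_cons xs orbT.
have near12 x y : x \in s -> y \in s -> x != y ->
    x + 2 * y \in near_even_sums (2 * m :: s).
  by move=> xs ys xy; apply: near_even_sums2; rewrite ?in_cons ?xs ?ys ?orbT.
have nearm x : x \in s -> 2 * m + 2 * x \in near_even_sums (2 * m :: s).
  move=> xs; have := s_lt x xs => x_lt.
  by apply: near_even_sums2; rewrite ?in_cons ?xs ?eqxx ?orbT //; lia.
have odd_facts c : c \in s -> odd_int c ->
    [/\ 2 * m < 3 * c < 4 * m, c < m -> c + m \in s & m < c -> c - m \in s].
  move=> cs c_odd; have c_lt := s_lt c cs; have [q cE] := c_odd.
  have c3 : 2 * m < 3 * c < 4 * m.
    apply/andP; split; rewrite ltNge; apply/negP => c3.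
      have [x xs [xc]] : exists2 x, x \in s & x != c /\
      [\/ c + 2 * x < 2 * m /\ 2 * m + 2 * c = 2 * m + 2 * x,
          2 * m < c + 2 * x < 4 * m /\ 2 * m + 2 * c = c + 2 * x
        | 4 * m < c + 2 * x /\ 2 * m + 2 * c = 2 * x].
        by apply: high => //; [apply: nearm | lia].
      by case; lia.
    have [x xs [xc]] := high c (2 * c) cs c_odd (near2 c cs) ltac:(lia).
    by case; lia.
  split=> // ltc.
    have [x xs [xc]] := high c (2 * m + 2 * c) cs c_odd (nearm c cs) ltac:(lia).
    by case=> -[h zE]; (try lia); have -> : c + m = x by lia.
  have [x xs [xc]] := high c (2 * c) cs c_odd (near2 c cs) ltac:(lia).
  by case=> -[h zE]; (try lia); have -> : c - m = x by lia.
(* For even [m], one of [c0 + m] and [c0 - m] would be an odd element of [s] outside the range given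
   by [odd_facts]. *)
have m_odd : odd_int m.
  case: (even_or_odd m) => // -[p mE]; have [q cE] := c0_odd.
  have [c3 lt gt] := odd_facts c0 c0s c0_odd.
  have [ltc|gtc|ceq] := ltgtP c0 m; last by lia.
    have [| + _ _] := odd_facts _ (lt ltc); first by exists (q + p); lia.
    by lia.
  have [| + _ _] := odd_facts _ (gt gtc); first by exists (q - p); lia.
  by lia.
have [p mE] := m_odd.
(* Otherwise, with [x = 2 * q], every odd [c] in [s] satisfies [c + 2 * x < 2 * m], so [low] puts
   [c + 2 * x] in [s]. Iterating from [c0] gives an unbounded progression inside [s]. *)
have even_large q : 2 * q \in s -> m < 2 * q.
  move=> xs; have x_lt := s_lt _ xs.
  rewrite ltNge; apply/negP => xm; have {}xm : 2 * q < m by lia.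
  have odd_small c : c \in s -> odd_int c -> c + 2 * (2 * q) < 2 * m.
    move=> cs c_odd; have [c3 _ _] := odd_facts c cs c_odd; have [r cE] := c_odd.
    have [y ys [yc]] := high c (2 * m + 2 * (2 * q)) cs c_odd (nearm _ xs) ltac:(lia).
    case=> -[h zE]; [lia | lia |].
    have [|y3 _ _] := odd_facts y ys; first by exists (q + p); lia.
    by lia.
  have all_k k : c0 + k%:Z * (2 * (2 * q)) \in s.
    elim: k => [|k IH]; first by rewrite mul0r addr0.
    have [r cE] := c0_odd.
    have IHodd : odd_int (c0 + k%:Z * (2 * (2 * q))) by exists (r + k%:Z * (2 * q)); lia.
    have lt := odd_small _ IH IHodd.
    have -> : c0 + k.+1%:Z * (2 * (2 * q)) = c0 + k%:Z * (2 * (2 * q)) + 2 * (2 * q) by lia.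
    apply: (low _ _ IH IHodd).
      apply: near12 => //; apply/eqP => E; have [t tE] := IHodd; lia.
    by have := s_lt _ IH; lia.
  have := s_lt _ (all_k `|m|%N); have := s_lt _ c0s.
  have -> : (`|m|%N)%:Z = m by lia.
  by nia.
have odd_le_m c : c \in s -> odd_int c -> c <= m.
  move=> cs c_odd; rewrite leNgt; apply/negP => mc.
  have [c3 _ /(_ mc) cms] := odd_facts c cs c_odd; have [r cE] := c_odd.
  have := even_large (r - p); have -> : 2 * (r - p) = c - m by lia.
  by move=> /(_ cms); lia.
(* By [high], [2 * (2 * q)] comes either from [y = 2 * q], which is the claim, or from the odd
   element [y = 2 * q - m], which is too small for [odd_facts]. *)
have even_high c q : c \in s -> odd_int c -> 2 * q \in s -> 4 * m < c + 2 * (2 * q).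
  move=> cs c_odd xs; have xm := even_large q xs; have x_lt := s_lt _ xs.
  have [c3 _ _] := odd_facts c cs c_odd; have [r cE] := c_odd.
  have [y ys [yc]] := high c (2 * (2 * q)) cs c_odd (near2 _ xs) ltac:(lia).
  case=> -[h zE]; [|lia|lia].
  have [|y3 _ _] := odd_facts y ys; first by exists (q - p - 1); lia.
  by lia.
(* By parity [c + 2 * c'] can only be [c' + 2 * x], so the midpoint [x] of [c] and [c'] is in [s].
   It is odd by [even_high], and replacing [c] by [x] starts an infinite descent. *)
have odd_unique c c' : c \in s -> odd_int c -> c' \in s -> odd_int c' -> c < c' -> False.
  move=> cs c_odd c's c'_odd.
  have [k] := ubnP `|c' - c|%N; elim: k => // k IH in c cs c_odd *; move=> lek lt.
  have [c3 _ _] := odd_facts c cs c_odd; have [c'3 _ _] := odd_facts c' c's c'_odd.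
  have [r cE] := c_odd; have [r' c'E] := c'_odd.
  have cm := odd_le_m c cs c_odd; have c'm := odd_le_m c' c's c'_odd.
  have [x xs [xc]] := high c' (c + 2 * c') c's c'_odd (near12 _ _ cs c's ltac:(lia)) ltac:(lia).
  case=> -[h zE]; [lia| |lia].
  have [[q xE]|x_odd] := even_or_odd x.
    by have := even_high c' q c's c'_odd; rewrite -xE => /(_ xs); lia.
  by apply: (IH x xs x_odd); lia.
have [c3 c0_lt _] := odd_facts c0 c0s c0_odd; have [r c0E] := c0_odd.
have even_of x : x \in s -> x != c0 -> exists q, x = 2 * q.
  move=> xs xc; have [//|x_odd] := even_or_odd x; exfalso.
  have [lt|gt|E] := ltgtP x c0; last by rewrite E eqxx in xc.
    exact: (odd_unique x c0).
  exact: (odd_unique c0 x).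
(* The map from [x] to [x / 2 + c0] halves the distance to [2 * c0]. If [c0 < m], it descends
   forever from [c0 + m]; if [c0 = m], it ascends forever from any other element of [s], below
   [2 * m]. *)
have mid x : x \in s -> x != c0 -> x + 2 * c0 < 4 * m ->
    exists y, [/\ y \in s, y != c0 & 2 * y = x + 2 * c0].
  move=> xs xc lt; have [q xE] := even_of x xs xc.
  have xm : m < x by rewrite xE; apply: even_large; rewrite -xE.
  have [y ys [yc]] := high c0 _ c0s c0_odd (near12 _ _ xs c0s xc) ltac:(lia).
  case=> -[h zE]; [|lia|by exists y].
  have [t yE] := even_of y ys yc.
  by have := even_high c0 t c0s c0_odd; rewrite -yE => /(_ ys); lia.
have [c0m|c0m] : c0 < m \/ c0 = m by have := odd_le_m c0 c0s c0_odd; lia.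
  have es := c0_lt c0m.
  suff descent k x : x \in s -> x != c0 -> 2 * c0 < x -> x <= c0 + m ->
      (`|(x - 2 * c0)%R| < k)%N -> False.
    by apply: (descent `|(m - c0)%R|%N.+1 (c0 + m)) => //; lia.
  elim: k x => // k IH x xs xc gt le lek.
  have [y [ys yc yE]] := mid x xs xc ltac:(lia).
  by apply: (IH y) => //; lia.
have [y ys yc] : exists2 y, y \in s & y != c0.
  move: s_size s_uniq; case: (s) => [|u [|v t]] //= _ /andP[].
  rewrite in_cons negb_or => /andP[uv _] _.
  have [uc|uc] := eqVneq u c0; last by exists u; rewrite ?mem_head.
  by exists v; rewrite ?in_cons ?eqxx ?orbT // -uc eq_sym.
suff ascent k x : x \in s -> x != c0 -> (`|(2 * m - x)%R| < k)%N -> False.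
  by apply: (ascent `|(2 * m - y)%R|%N.+1 y).
elim: k x => // k IH x xs xc lek; have x_lt := s_lt x xs.
have [z [zs zc zE]] := mid x xs xc ltac:(lia).
by apply: (IH z) => //; lia.
Qed.

(** For [n = size s], the count is [n + 2] for 0, [b] and the elements of [s], plus [n] further
    elements above [b]. *)
Lemma window_card_odd (b c : int) (s : seq int) :
  uniq s -> (2 <= size s)%N -> {in s, forall x : int, 0 < x < b} ->
  c \in b :: s -> odd_int c ->
  exists L, [/\ uniq L, size L = (2 * (size s).+1)%N
    & {in L, forall x : int, x \in near_even_sums (b :: s) /\ x < 2 * b}].
Proof.
move=> s_uniq s_size s_lt cs c_odd.
have b_gt0 : 0 < b.
  by case: (s) s_size s_lt => // x t _ /(_ x (mem_head _ _)); lia.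
have low : {in 0 :: b :: s, forall x : int, x \in near_even_sums (b :: s) /\ x < 2 * b}.
  move=> x; rewrite in_cons => /orP[/eqP-> | xs].
    by split; [apply/even_sums_near/even_sums0 | lia].
  split; first exact: near_even_sums1.
  by move: xs; rewrite in_cons => /orP[/eqP-> | /s_lt]; lia.
have low_uniq : uniq (0 :: b :: s).
  rewrite /= s_uniq andbT in_cons negb_or -andbA; apply/and3P; split; first by lia.
    by apply/negP => /s_lt; lia.
  by apply/negP => /s_lt; lia.
have low_le x : x \in 0 :: b :: s -> x <= b.
  by rewrite !in_cons => /or3P[/eqP->|/eqP->|/s_lt]; lia.
have near2 x : x \in s -> 2 * x \in near_even_sums (b :: s).
  by move=> xs; apply/even_sums_near/even_sums1; rewrite in_cons xs orbT.
have nearb x : x \in s -> b + 2 * x \in near_even_sums (b :: s).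
  move=> xs; have := s_lt x xs => x_lt.
  by apply: near_even_sums2; rewrite ?in_cons ?xs ?eqxx ?orbT //; lia.
(* When [b] is odd, [b + 2 * x] and [2 * y] never collide. *)
have [[m bE]|[m bE]] := even_or_odd b; last first.
  exists ((0 :: b :: s) ++ [seq if b < 2 * x then 2 * x else b + 2 * x | x <- s]).
  split; last 2 first.
  - by rewrite size_cat size_map /=; lia.
  - move=> x; rewrite mem_cat => /orP[/low // | /mapP[y ys ->]].
    have y_lt := s_lt y ys.
    by case: ifP => h; split; [apply: near2 | lia | apply: nearb | lia].
  rewrite cat_uniq low_uniq /=; apply/andP; split.
    apply/hasPn => _ /mapP[y ys ->]; apply/negP => /low_le; have := s_lt y ys.
    by case: ifP => ?; lia.
  rewrite map_inj_in_uniq // => x y xs ys; have := s_lt y ys; have := s_lt x xs.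
  by do 2?[case: ifP => ?]; lia.
have {}cs : c \in s.
  by move: cs; rewrite in_cons => /orP[/eqP cE|//]; case: c_odd; lia.
pose win := [seq z : int <- undup (near_even_sums (b :: s)) | z < 2 * b].
have win_uniq : uniq win by rewrite filter_uniq ?undup_uniq.
have winE (z : int) : (z \in win) = (z < 2 * b) && (z \in near_even_sums (b :: s)).
  by rewrite mem_filter mem_undup.
(* When [b] is even, each odd [e] in [s] gives a list [L] that is one short of the
   bound; failing it would force every such [L] to exhaust the window. *)
have [le|lt] := leqP (2 * (size s).+1) (size win).
  exists (take (2 * (size s).+1) win); split; first exact: take_uniq.
    by rewrite size_takel.
  by move=> x /mem_take; rewrite winE => /andP[].
exfalso; apply: (@tight_window_absurd m c s) => //; first by rewrite -bE.
rewrite -bE => e z es [q eE] zn zlt.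
pose L : seq int := (0 :: b :: s) ++ [seq window_elt b e x | x <- rem e s].
have memL : {subset L <= win}.
  move=> x; rewrite winE mem_cat => /orP[/low[-> ->] // | /mapP[y]].
  rewrite mem_rem_uniq // inE => /andP[ye ys] ->.
  have y_lt := s_lt y ys; have e_lt := s_lt e es; rewrite /window_elt.
  case: ifP => h1; first by rewrite nearb // andbT; lia.
  case: ifP => h2; last by rewrite near2 // andbT; lia.
  by rewrite h2 near_even_sums2 ?in_cons ?ys ?es ?orbT // eq_sym.
have L_uniq : uniq L.
  have e_lt := s_lt e es.
  rewrite cat_uniq low_uniq /=; apply/andP; split.
    apply/hasPn => _ /mapP[y /mem_rem ys ->]; apply/negP => /low_le.
    by have := s_lt y ys; rewrite /window_elt; do 2?[case: ifP => ?]; lia.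
  rewrite map_inj_in_uniq ?rem_uniq // => x y /mem_rem xs /mem_rem ys.
  have := s_lt y ys; have := s_lt x xs; rewrite /window_elt.
  by do 4?[case: ifP => ?]; lia.
have L_size : (size win <= size L)%N.
  rewrite size_cat size_map size_rem //=; move: lt; lia.
have [_ LE] := uniq_min_size L_uniq memL L_size.
have : z \in L by rewrite LE winE zn andbT; lia.
rewrite mem_cat in_cons -orbA => /or3P[/eqP-> | zs | /mapP[x]].
- by constructor 1.
- by constructor 2.
rewrite mem_rem_uniq // inE => /andP[xe xs] ->.
by constructor 3; exists x.
Qed.

(** All elements are halved as long as they are all even; this stops because the positive head [b]
    decreases. *)
Lemma scale_to_odd (b : int) (s : seq int) :
  0 < b -> exists q t c,
    [/\ 0 < q, b :: s = scale q t, c \in t & odd_int c].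
Proof.
have [k] := ubnP `|b|%N; elim: k => // k IH in b s *; rewrite ltnS => bk b_gt0.
have [/hasP[c cs /eqP c2]|/hasPn evens] := boolP (has (fun x : int => (x %% 2)%Z == 1) (b :: s)).
  exists 1, (b :: s), c; split=> //; first by rewrite /scale (eq_map (@mul1r _)) map_id.
  by exists (c %/ 2)%Z; have := divz_eq c 2; lia.
have half : {in b :: s, forall x : int, x = 2 * (x %/ 2)%Z}.
  move=> x xs; have [[q ->]|[q xE]] := even_or_odd x; first by lia.
  by have := evens x xs; lia.
have bE := half b (mem_head _ _).
have [|q [t [c [q_gt0 tE ct c_odd]]]] := IH (b %/ 2)%Z [seq (x %/ 2)%Z | x <- s] _ ltac:(lia).
  by lia.
exists (2 * q), t, c; split=> //; first by lia.
have -> : scale (2 * q) t = scale 2 (scale q t).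
  by rewrite /scale -map_comp; apply: eq_map => x /=; rewrite mulrA.
rewrite -tE -[(b %/ 2)%Z :: _]/([seq (x %/ 2)%Z | x : int <- b :: s]) /scale -map_comp.
by rewrite -[LHS]map_id; apply/eq_in_map => x /half.
Qed.

Lemma window_card (b : int) (s : seq int) :
  uniq s -> (2 <= size s)%N -> {in s, forall x : int, 0 < x < b} ->
  exists L, [/\ uniq L, size L = (2 * (size s).+1)%N
    & {in L, forall x : int, x \in near_even_sums (b :: s) /\ x < 2 * b}].
Proof.
move=> s_uniq s_size s_lt.
have b_gt0 : 0 < b.
  by case: (s) s_size s_lt => // x t _ /(_ x (mem_head _ _)); lia.
have [q [[|a t] [c [q_gt0 tE ct c_odd]]]] := scale_to_odd s b_gt0; first by [].
case: (tE) => bE sE.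
have q_inj : injective ( *%R q) by apply: mulfI; lia.
have t_uniq : uniq t by move: s_uniq; rewrite sE /scale map_inj_uniq.
have t_size : size s = size t by rewrite sE /scale size_map.
have [|x xt|L [L_uniq L_size Lw]] := window_card_odd t_uniq _ _ ct c_odd.
- by rewrite -t_size.
- have : q * x \in s by rewrite sE mem_scale.
  by move/s_lt; rewrite bE; nia.
exists [seq q * x | x <- L]; split; first by rewrite map_inj_uniq.
  by rewrite size_map L_size t_size.
move=> _ /mapP[x /Lw[xn xb] ->]; split; last by rewrite bE; nia.
by rewrite tE near_even_sums_scale mem_scale.
Qed.

(** For [n = size s], the gain [2 * (n + 1)] is exactly the increment of [n * (n + 1) + 1], so an
    upper bound of this form passes from [b :: s] to [s]. *)
Lemma near_even_sums_step (b : int) (s : seq int) :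
  uniq s -> (2 <= size s)%N -> {in s, forall x : int, 0 < x < b} ->
  (distinct (near_even_sums s) + 2 * (size s).+1
     <= distinct (near_even_sums (b :: s)))%N.
Proof.
move=> s_uniq s_size s_lt.
have [L [L_uniq <- Lw]] := window_card s_uniq s_size s_lt.
by apply: near_even_sums_window => // x /s_lt; lia.
Qed.

(** * Extremal sets for h = n *)

Fixpoint countdown (n : nat) : seq int :=
  if n is m.+1 then n%:Z :: countdown m else [::].

Lemma size_countdown (n : nat) : size (countdown n) = n.
Proof. by elim: n => //= n ->. Qed.

Lemma mem_countdown (n : nat) (x : int) : (x \in countdown n) = (0 < x <= n%:Z).
Proof. by elim: n => [|n IH]; rewrite ?in_nil ?in_cons ?IH; lia. Qed.

Lemma countdown_uniq (n : nat) : uniq (countdown n).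
Proof. by elim: n => //= n ->; rewrite mem_countdown andbT; lia. Qed.

(** Bounding the sums of the tail from below limits the window of an extremal extension to
    [2 * n + 2] elements. *)
Lemma near_countdown_card (n : nat) :
  (3 <= n)%N -> (n * n.+1 + 1 <= distinct (near_even_sums (countdown n)))%N.
Proof.
elim: n => // n IH; rewrite leq_eqVlt => /orP[/eqP <- | n3]; first by vm_compute.
have := @near_even_sums_step n.+1%:Z (countdown n) (countdown_uniq n).
rewrite size_countdown -[_ :: _]/(countdown n.+1) => /(_ ltac:(lia)) step.
have {}step : (distinct (near_even_sums (countdown n)) + 2 * n.+1
    <= distinct (near_even_sums (countdown n.+1)))%N.
  by apply: step => x; rewrite mem_countdown; lia.
by have := IH n3; lia.
Qed.

(** An odd [2 * q + 1] is [1 + 2 * q], except that 1 and 3 are elements themselves; the even number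
    [2 * n + 2] is [2 * 1 + 2 * n]. *)
Lemma mem_near_countdown (n i : nat) :
  (3 <= n)%N -> (i <= 2 * n + 2)%N -> i%:Z \in near_even_sums (countdown n).
Proof.
move=> n3 le; have [[q iE]|[q iE]] := even_or_odd i%:Z; last first.
  have [le1|gt1] := leP q 1.
    by apply: near_even_sums1; rewrite mem_countdown; lia.
  rewrite iE addrC; apply: near_even_sums2; rewrite ?mem_countdown; lia.
rewrite iE; apply: even_sums_near; have [->|q0] := eqVneq q 0.
  exact: even_sums0.
have [le1|gt1] := leP q n%:Z; first by apply: even_sums1; rewrite mem_countdown; lia.
have -> : 2 * q = 2 * 1 + 2 * n%:Z by lia.
by apply: even_sums2; rewrite ?mem_countdown; lia.
Qed.

(** * Extending an extremal set by a larger element *)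

Lemma mem_near_scaled (b d x : int) (s : seq int) :
  x \in near_even_sums s -> d * x \in near_even_sums (b :: scale d s).
Proof.
by move=> xs; rewrite mem_near_even_sums_cons near_even_sums_scale mem_scale.
Qed.

Lemma mem_near_shift (b d x : int) (s : seq int) :
  x \in near_even_sums s -> 2 * b + d * x \in near_even_sums (b :: scale d s).
Proof.
move=> xs; rewrite mem_near_even_sums_cons [2 * b + _]addrC addrK near_even_sums_scale.
by rewrite mem_scale ?orbT.
Qed.

Lemma mem_even_scaled (b d x : int) (s : seq int) :
  x \in even_sums s -> b + d * x \in near_even_sums (b :: scale d s).
Proof.
move=> xs; rewrite mem_near_even_sums_cons [b + _]addrC addrK even_sums_scale.
by rewrite mem_scale ?orbT.
Qed.

(** Any other [b] puts [2 * n + 3] elements below [2 * b], one too many. If [b] exceeds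
    [(n + 1) * d], these are the multiples [d * i] with [i <= 2 * n + 2]. If [b] is smaller, it is
    not a multiple of [d], and they are [b], [b + 2 * d] and the [d * i] with [i <= 2 * n]. *)
Lemma near_countdown_extend (b d : int) (n : nat) :
  (3 <= n)%N -> 0 < d -> n%:Z * d < b ->
  (distinct (near_even_sums (b :: scale d (countdown n)))
     <= n.+1 * n.+2 + 1)%N ->
  b = n.+1%:Z * d.
Proof.
move=> n3 d_gt0 ltb le.
have d_inj : injective ( *%R d) by apply: mulfI; lia.
have scale_inj : injective (fun i : nat => d * i%:Z) by move=> i j /d_inj; lia.
have window (L : seq int) : uniq L ->
    {in L, forall x : int, x \in near_even_sums (b :: scale d (countdown n))
                           /\ x < 2 * b} -> (size L <= 2 * n.+1)%N.
  move=> L_uniq Lw; have := near_even_sums_window _ L_uniq Lw.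
  rewrite near_even_sums_scale distinct_scale ?gt_eqF //.
  have := near_countdown_card n3 => card /(_ _).
  have s_gt0 : {in scale d (countdown n), forall y : int, 0 < y}.
    by move=> _ /mapP[y + ->]; rewrite mem_countdown; nia.
  by move=> /(_ s_gt0); lia.
have multiple i : (i <= 2 * n + 2)%N ->
    d * i%:Z \in near_even_sums (b :: scale d (countdown n)).
  by move=> ilt; apply/mem_near_scaled/mem_near_countdown.
have [lt|gt|//] := ltgtP b (n.+1%:Z * d); last first.
  have := window [seq d * i%:Z | i <- iota 0 (2 * n + 3)].
  rewrite map_inj_uniq // iota_uniq size_map size_iota => /(_ isT).
  suff lw : {in [seq d * i%:Z | i <- iota 0 (2 * n + 3)], forall x : int,
      x \in near_even_sums (b :: scale d (countdown n)) /\ x < 2 * b}.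
    by move=> /(_ lw); lia.
  move=> _ /mapP[i + ->]; rewrite mem_iota => ilt; split; first by apply: multiple; lia.
  have : d * i%:Z <= d * (2 * n + 2)%N%:Z by (rewrite ler_pM2l; lia).
  by lia.
have nmul (j : int) : b != d * j.
  apply/eqP => bE; move: lt ltb; rewrite bE ![_ * d]mulrC !ltr_pM2l //; lia.
have b2d : b + 2 * d < 2 * b by nia.
have := window ([:: b; b + 2 * d] ++ [seq d * i%:Z | i <- iota 0 (2 * n + 1)]).
rewrite size_cat size_map size_iota /= map_inj_uniq // iota_uniq andbT => big.
suff : (2 + (2 * n + 1) <= 2 * n.+1)%N by lia.
apply: big.
  rewrite in_cons negb_or -andbA; apply/and3P; split; first by lia.
    by apply/negP => /mapP[i _ E]; have := nmul i%:Z; rewrite E eqxx.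
  by apply/negP => /mapP[i _ E]; have /eqP := nmul (i%:Z - 2); apply; lia.
move=> x; rewrite !in_cons => /or3P[/eqP-> | /eqP-> | /mapP[i + ->]].
- by split; [apply: near_even_sums1; rewrite mem_head | lia].
- split=> //; rewrite [2 * d]mulrC; apply/mem_even_scaled.
  rewrite -[2]mulr1; apply: even_sums1; rewrite mem_countdown; lia.
rewrite mem_iota => ilt; split; first by apply: multiple; lia.
have : d * i%:Z <= d * (2 * n)%N%:Z by (rewrite ler_pM2l; lia).
by nia.
Qed.

(** The tool for the small cases: an explicit increasing list of more than [m - N] elements below
    [2 * b] gives a contradiction. *)
Lemma window_bound (b d : int) (s L : seq int) (m N : nat) :
  {in s, forall y : int, 0 < y} -> 0 < d ->
  (N <= distinct (near_even_sums s))%N ->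
  (distinct (near_even_sums (b :: scale d s)) <= m)%N ->
  sorted <%R L ->
  all (fun x => x < 2 * b) L ->
  all (fun x => x \in near_even_sums (b :: scale d s)) L ->
  (N + size L <= m)%N.
Proof.
move=> s_gt0 d_gt0 leN lem /lt_sorted_uniq L_uniq /allP Lb /allP Ln.
have ds_gt0 : {in scale d s, forall y : int, 0 < y} by move=> _ /mapP[y /s_gt0 ? ->]; nia.
have := @near_even_sums_window b _ _ ds_gt0 L_uniq (fun x xL => conj (Ln x xL) (Lb x xL)).
by rewrite near_even_sums_scale distinct_scale ?gt_eqF //; lia.
Qed.

(** The eight admissible coefficient pairs give eight different sums unless [b = 2 * a]. *)
Lemma near_even_sums_pair (a b : int) :
  0 < a -> a < b -> (distinct (near_even_sums [:: b; a]) <= 7)%N -> b = 2 * a.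
Proof.
move=> a_gt0 ab; have [-> //|b2a] := eqVneq b (2 * a); rewrite leqNgt => /negP[].
apply: (@leq_distinct [:: 0; a; b; 2 * a; 2 * b; b + 2 * a; a + 2 * b; 2 * a + 2 * b]).
  by rewrite /= !inE; lia.
have ba : b != a by rewrite gt_eqF.
have [as_ bs] : a \in [:: b; a] /\ b \in [:: b; a] by rewrite !inE !eqxx orbT.
apply/allP; rewrite /=; do 8?[apply/andP; split=> //].
- exact: near_even_sums1.
- exact: near_even_sums1.
- exact/even_sums_near/even_sums1.
- exact/even_sums_near/even_sums1.
- exact: near_even_sums2.
- by apply: near_even_sums2; rewrite // eq_sym.
- by apply/even_sums_near/even_sums2; rewrite // eq_sym.
Qed.

(** The bound is [13 = 3 * 4 + 1], and [[:: 2; 1]] has 6 sums, one less than [2 * 3 + 1]. This slack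
    lets [4 * d] in, and a contradiction takes 8 elements of the window. *)
Lemma near_even_sums_extend_21 (b d : int) :
  0 < d -> 2 * d < b ->
  (distinct (near_even_sums (b :: scale d [:: 2; 1]))%R <= 13)%N ->
  b = 3 * d \/ b = 4 * d.
Proof.
move=> d_gt0 ltb le.
have s_gt0 : {in [:: 2; 1], forall y : int, 0 < y} by apply/allP.
have bound L := @window_bound b d [:: 2; 1] L 13 6 s_gt0 d_gt0 isT le.
have [->|b3] := eqVneq b (3 * d); first by left.
have [->|b4] := eqVneq b (4 * d); first by right.
exfalso; have [lt3|ge3] := ltP b (3 * d).
  (* Here at most 7 sums lie below [2 * b], so 14 sums of the whole set are listed. *)
  suff : (14 <= 13)%N by [].
  apply: leq_trans le; pose L := [:: d * 0; d * 1; d * 2; b + d * 0; d * 4; b + d * 2;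
    d * 5; d * 6; b + d * 4; 2 * b + d * 2; b + d * 6; 2 * b + d * 4; 2 * b + d * 5;
    2 * b + d * 6].
  apply: (@leq_distinct L).
    by apply: lt_sorted_uniq; rewrite /L /=; clear - d_gt0 ltb lt3; lia.
  apply/allP; rewrite /L /= !mem_near_scaled // !mem_even_scaled //.
  by rewrite !mem_near_shift.
have [lt4|ge4] := ltP b (4 * d).
  have := bound [:: d * 0; d * 1; d * 2; b + d * 0; d * 4; d * 5; b + d * 2; d * 6].
  rewrite /= !mem_near_scaled // !mem_even_scaled // => /(_ ltac:(lia)).
  by move=> /(_ ltac:(lia) isT).
have [lt5|ge5] := ltP b (5 * d).
  have := bound [:: d * 0; d * 1; d * 2; d * 4; b + d * 0; d * 5; d * 6; b + d * 2].
  rewrite /= !mem_near_scaled // !mem_even_scaled // => /(_ ltac:(lia)).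
  by move=> /(_ ltac:(lia) isT).
have [lt7|ge7] := ltP b (7 * d).
  have := bound [:: d * 0; d * 1; d * 2; d * 4; d * 5; d * 6; b + d * 2; b + d * 4].
  rewrite /= !mem_near_scaled // !mem_even_scaled // => /(_ ltac:(lia)).
  by move=> /(_ ltac:(lia) isT).
have := bound [:: d * 0; d * 1; d * 2; d * 4; d * 5; d * 6; b + d * 0; b + d * 2].
rewrite /= !mem_near_scaled // !mem_even_scaled // => /(_ ltac:(lia)).
by move=> /(_ ltac:(lia) isT).
Qed.

(** Since [21 = 4 * 5 + 1] and the tail has at least 12 sums, 10 elements below [2 * b] give a
    contradiction. *)
Lemma near_even_sums_extend_421 (b d : int) :
  0 < d -> 4 * d < b ->
  (distinct (near_even_sums (b :: scale d [:: 4; 2; 1]))%R <= 21)%N ->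
  b = 6 * d.
Proof.
move=> d_gt0 ltb le.
have s_gt0 : {in [:: 4; 2; 1], forall y : int, 0 < y} by apply/allP.
have card : (12 <= distinct (near_even_sums [:: 4; 2; 1])%R)%N by vm_compute.
have bound L := @window_bound b d [:: 4; 2; 1] L 21 12 s_gt0 d_gt0 card le.
have [-> //|b6] := eqVneq b (6 * d); exfalso.
(* For [b = 5 * d] the window has only 9 elements, so the full set of sums is counted. *)
have [b5|b5] := eqVneq b (5 * d).
  move: le; have -> : b :: scale d [:: 4; 2; 1] = scale d [:: 5; 4; 2; 1].
    by rewrite b5 /scale /= mulrC.
  by rewrite near_even_sums_scale distinct_scale ?gt_eqF // leqNgt => /negP[]; vm_compute.
have [lt5|ge5] := ltP b (5 * d).
  have := bound [:: d * 0; d * 1; d * 2; d * 4; b + d * 0; d * 5; d * 6; b + d * 2; d * 8;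
                    b + d * 4].
  rewrite /= !mem_near_scaled // !mem_even_scaled // => /(_ ltac:(lia)).
  by move=> /(_ ltac:(lia) isT).
have [lt6|ge6] := ltP b (6 * d).
  have := bound [:: d * 0; d * 1; d * 2; d * 4; d * 5; b + d * 0; d * 6; b + d * 2; d * 8;
                    b + d * 4].
  rewrite /= !mem_near_scaled // !mem_even_scaled // => /(_ ltac:(lia)).
  by move=> /(_ ltac:(lia) isT).
have := bound [:: d * 0; d * 1; d * 2; d * 4; d * 5; d * 6; d * 8; d * 9; d * 10; d * 12].
rewrite /= !mem_near_scaled // => /(_ ltac:(lia)).
by move=> /(_ ltac:(lia) isT).
Qed.

(** Since [31 = 5 * 6 + 1] and the tail has at least 21 sums, 11 elements below [2 * b] suffice. *)
Lemma near_even_sums_extend_6421 (b d : int) :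
  0 < d -> 6 * d < b ->
  (31 < distinct (near_even_sums (b :: scale d [:: 6; 4; 2; 1]))%R)%N.
Proof.
move=> d_gt0 ltb; rewrite ltnNge; apply/negP => le.
have s_gt0 : {in [:: 6; 4; 2; 1], forall y : int, 0 < y} by apply/allP.
have card : (21 <= distinct (near_even_sums [:: 6; 4; 2; 1])%R)%N by vm_compute.
have bound L := @window_bound b d [:: 6; 4; 2; 1] L 31 21 s_gt0 d_gt0 card le.
(* If [13 * d] is not below [2 * b], then [b] lies strictly between [6 * d] and [8 * d] and replaces
   it in the list. *)
have [le13|gt13] := leP (2 * b) (13 * d).
  have := bound [:: d * 0; d * 1; d * 2; d * 4; d * 5; d * 6; b + d * 0; d * 8; d * 9;
                    d * 10; d * 12].
  rewrite /= !mem_near_scaled // !mem_even_scaled // => /(_ ltac:(lia)).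
  by move=> /(_ ltac:(lia) isT).
have := bound [:: d * 0; d * 1; d * 2; d * 4; d * 5; d * 6; d * 8; d * 9; d * 10; d * 12;
                  d * 13].
rewrite /= !mem_near_scaled // => /(_ ltac:(lia)).
by move=> /(_ ltac:(lia) isT).
Qed.

Lemma sorted_gt_cons (b : int) (s : seq int) :
  sorted >%R (b :: s) -> {in b :: s, forall x : int, 0 < x} ->
  [/\ sorted >%R s, uniq s, {in s, forall x : int, 0 < x}
    & {in s, forall x : int, 0 < x < b}].
Proof.
move=> bs pos; have trans : transitive (>%R : rel int) by move=> x y z; lia.
have s_pos : {in s, forall x : int, 0 < x} by move=> x xs; apply: pos; rewrite in_cons xs orbT.
have ss := path_sorted bs; split=> //.
  by apply: (sorted_uniq trans) ss => x; rewrite /= ltxx.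
by move=> x xs; have /allP/(_ x xs) := order_path_min trans bs; have := s_pos x xs; lia.
Qed.

Definition extremal (n : nat) (s : seq int) : Prop :=
  exists2 d : int, 0 < d &
    [\/ s = scale d (countdown n),
        n = 3%N /\ s = scale d [:: 4; 2; 1]
      | n = 4%N /\ s = scale d [:: 6; 4; 2; 1]].

(** Induction removing the largest element: [near_even_sums_step] passes the bound to the tail, and
    the extension lemmas then determine the head. *)
Lemma near_even_sums_inverse (s : seq int) :
  sorted >%R s -> {in s, forall x : int, 0 < x} -> (2 <= size s)%N ->
  (distinct (near_even_sums s) <= size s * (size s).+1 + 1)%N ->
  extremal (size s) s.
Proof.
elim: s => // b s IH bs_sorted bs_pos s_size le.
have [s_sorted s_uniq s_pos s_lt] := sorted_gt_cons bs_sorted bs_pos.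
have [s2|s2] := leqP 2 (size s); last first.
  move: s_size s2 s_lt le; rewrite /extremal.
  case: (s) => [|a [|//]] // _ _ /(_ a (mem_head _ _)) /andP[a_gt0 ab] le.
  have b2a := near_even_sums_pair a_gt0 ab le.
  by exists a => //; constructor 1; rewrite /scale /= mulr1 b2a mulrC.
have step := near_even_sums_step s_uniq s2 s_lt.
have [|d d_gt0] := IH s_sorted s_pos s2; first by move: le step; rewrite /=; lia.
have head_lt x t : s = scale d t -> x \in t -> d * x < b.
  move=> sE xt; have xs : d * x \in s by rewrite sE mem_scale.
  by have := s_lt _ xs; lia.
case=> [sE | [s3 sE] | [s4 sE]].
- have [s3|s3] := leqP 3 (size s).
    exists d => //; constructor 1; rewrite -[size _]/(size s).+1 /=.
    rewrite /scale /= -/(scale d _) -sE; congr (_ :: _); rewrite mulrC.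
    apply: near_countdown_extend => //; last by rewrite -sE.
    by rewrite mulrC; apply: (head_lt _ _ sE); rewrite mem_countdown; lia.
  have s2E : size s = 2%N by lia.
  move: le sE; rewrite /extremal -[size (_ :: _)]/(size s).+1 s2E => le sE.
  have [|||bE|bE] := @near_even_sums_extend_21 b d => //.
  + by rewrite mulrC; apply: (head_lt _ _ sE).
  + by rewrite sE in le.
  + by exists d => //; constructor 1; rewrite bE sE /scale /= mulrC.
  + by exists d => //; constructor 2; split=> //; rewrite bE sE /scale /= mulrC.
- move: le; rewrite /extremal -[size (_ :: _)]/(size s).+1 s3 => le.
  have bE : b = 6 * d.
    apply: near_even_sums_extend_421 => //; last by rewrite -sE.
    by rewrite mulrC; apply: (head_lt _ _ sE).
  by exists d => //; constructor 3; split=> //; rewrite bE sE /scale /= mulrC.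
- move: le; rewrite -[size (_ :: _)]/(size s).+1 s4 leqNgt sE near_even_sums_extend_6421 //.
  by rewrite mulrC; apply: (head_lt _ _ sE).
Qed.

(** * Signed sums of h elements *)

Fixpoint signed_sums (h : nat) (s : seq int) {struct s} : seq int :=
  if h is h'.+1 then
    if s is a :: s' then
      signed_sums h s' ++ [seq a + x | x <- signed_sums h' s']
        ++ [seq - a + x | x <- signed_sums h' s']
    else [::]
  else [:: 0].

Lemma signed_sums0 (s : seq int) : signed_sums 0 s = [:: 0].
Proof. by case: s. Qed.

Lemma mem_signed_sums_cons (h : nat) (a x : int) (s : seq int) :
  (x \in signed_sums h.+1 (a :: s)) =
  [|| x \in signed_sums h.+1 s, x - a \in signed_sums h s
    | x + a \in signed_sums h s].
Proof. by rewrite /= !mem_cat !mem_shift opprK. Qed.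

Arguments signed_sums : simpl never.

Lemma signed_sums_consW (h : nat) (a x : int) (s : seq int) :
  x \in signed_sums h s -> x \in signed_sums h (a :: s).
Proof. by case: h => [|h]; rewrite ?signed_sums0 // mem_signed_sums_cons => ->. Qed.

Lemma signed_sums_nil (h : nat) (s : seq int) (x : int) :
  (size s < h)%N -> (x \in signed_sums h s) = false.
Proof.
elim: s h x => [|a s IH] [|h] x //=; rewrite ltnS => lt.
by rewrite mem_signed_sums_cons !IH // ltnW.
Qed.

Lemma distinct_eq_mem (s t : seq int) : s =i t -> distinct s = distinct t.
Proof.
move=> st; apply/perm_size/uniq_perm; rewrite ?undup_uniq // => x.
by rewrite !mem_undup st.
Qed.

Lemma signed_sums_size (s : seq int) (x : int) :
  (x \in signed_sums (size s) s) = (list_sum s - x \in even_sums s).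
Proof.
elim: s x => [|a s IH] x; first by rewrite /list_sum /even_sums /signed_sums !inE /=; lia.
rewrite mem_signed_sums_cons signed_sums_nil // orFb !IH mem_even_sums_cons list_sum_cons.
by congr (_ || _); congr (in_mem _ _); lia.
Qed.

(** The 0 of the set of absolute values is put last, which keeps decreasing lists of positive
    numbers decreasing. *)
Definition with0 (s : seq int) : seq int := s ++ [:: 0].

Lemma with0_cons (a : int) (s : seq int) : with0 (a :: s) = a :: with0 s.
Proof. by []. Qed.

Arguments with0 : simpl never.

Lemma size_with0 (s : seq int) : size (with0 s) = (size s).+1.
Proof. by rewrite size_cat addn1. Qed.

Lemma even_sums_with0 (s : seq int) : even_sums (with0 s) =i even_sums s.
Proof.
elim: s => [|a s IH] x; last by rewrite with0_cons !mem_even_sums_cons !IH.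
by rewrite mem_even_sums_cons mulr0 subr0 orbb.
Qed.

Lemma list_sum_with0 (s : seq int) : list_sum (with0 s) = list_sum s.
Proof. by elim: s => // a s IH; rewrite with0_cons !list_sum_cons IH. Qed.

(** Choosing [size s] terms from [s] and 0 omits at most one element of [s]. Subtracting from
    [list_sum s] turns the signs 1 and -1 into 0 and 2, and an omission into 1. *)
Lemma signed_sums_near (s : seq int) (x : int) :
  (x \in signed_sums (size s) (with0 s)) = (list_sum s - x \in near_even_sums s).
Proof.
elim: s x => [|a s IH] x.
  by rewrite /list_sum /near_even_sums /signed_sums !inE /=; lia.
rewrite with0_cons mem_signed_sums_cons -{1}size_with0 signed_sums_size !IH.
rewrite even_sums_with0 list_sum_with0 mem_near_even_sums_cons list_sum_cons orbC -orbA.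
by congr [|| _, _ | _]; congr (in_mem _ _); lia.
Qed.

Lemma distinct_signed_sums_near (s : seq int) :
  distinct (signed_sums (size s) (with0 s)) = distinct (near_even_sums s).
Proof.
pose f (x : int) : int := list_sum s - x.
have f_inj : injective f by move=> x y; rewrite /f; lia.
have -> : distinct (near_even_sums s) = distinct (map f (near_even_sums s)).
  by rewrite /distinct undup_map_inj // size_map.
apply: distinct_eq_mem => x; rewrite signed_sums_near.
apply/idP/mapP => [xs|[y ys ->]]; last by rewrite /f opprB addrC subrK.
by exists (list_sum s - x); rewrite // /f opprB addrC subrK.
Qed.

Lemma signed_sums_scale (d : int) (h : nat) (s : seq int) :
  signed_sums h (scale d s) = scale d (signed_sums h s).
Proof.
elim: s h => [|a s IH] [|h]; rewrite ?signed_sums0 /scale /= ?mulr0 //.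
rewrite /signed_sums /= -!/(signed_sums _ _) -!/(scale d _) !IH /scale !map_cat -!map_comp.
congr (_ ++ (_ ++ _)); apply: eq_map => x /=; first by rewrite mulrDr.
by rewrite mulrDr mulrN.
Qed.

(** * Symmetry, maximum and growth of the signed sums *)

Lemma signed_sums_opp (h : nat) (s : seq int) (x : int) :
  (- x \in signed_sums h s) = (x \in signed_sums h s).
Proof.
elim: s h x => [|a s IH] [|h] x; rewrite ?signed_sums0 ?inE ?oppr_eq0 //.
rewrite !mem_signed_sums_cons IH -(IH h (x - a)) -(IH h (x + a)) opprB opprD.
by rewrite [a - x]addrC; congr (_ || _); rewrite orbC.
Qed.

Lemma list_sum_ge0 (s : seq int) : {in s, forall x : int, 0 <= x} -> 0 <= list_sum s.
Proof.
elim: s => // a s IH s_ge0; rewrite list_sum_cons.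
have := IH (fun x xs => s_ge0 x (@mem_behead _ (a :: s) x xs)).
by have := s_ge0 a (mem_head _ _); lia.
Qed.

Lemma list_sum_take_cons (h : nat) (a : int) (s : seq int) :
  0 <= a -> {in s, forall x : int, x <= a} ->
  list_sum (take h.+1 s) <= a + list_sum (take h s).
Proof.
move=> a_ge0; elim: s h => [|c s IH] h sa; first by rewrite /list_sum /=; lia.
have ca := sa c (mem_head _ _).
rewrite [take h.+1 _]/= list_sum_cons; case: h => [|h]; first by rewrite take0 /list_sum /=; lia.
rewrite [take h.+1 _]/= list_sum_cons.
have := IH h (fun x xs => sa x (@mem_behead _ (c :: s) x xs)).
by rewrite addrCA lerD2l.
Qed.

Lemma signed_sums_le (h : nat) (s : seq int) (x : int) :
  sorted >%R s -> {in s, forall x : int, 0 <= x} ->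
  x \in signed_sums h s -> x <= list_sum (take h s).
Proof.
elim: s h x => [|a s IH] [|h] x s_sorted s_ge0.
- by rewrite inE => /eqP->.
- by [].
- by rewrite signed_sums0 inE => /eqP->.
have trans : transitive (>%R : rel int) by move=> ? ? ?; lia.
have sa : {in s, forall y : int, y <= a}.
  by move=> y ys; have /allP/(_ y ys)/ltW := order_path_min trans s_sorted.
have a_ge0 := s_ge0 a (mem_head _ _).
have {}IH k y := IH k y (path_sorted s_sorted)
  (fun z zs => s_ge0 z (@mem_behead _ (a :: s) z zs)).
rewrite mem_signed_sums_cons [take _ _]/= list_sum_cons.
case/or3P => [/IH xle | /IH | /IH]; [|lia|lia].
exact: (le_trans xle (list_sum_take_cons h a_ge0 sa)).
Qed.

Lemma list_sum_take_signed_sums (h : nat) (s : seq int) :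
  (h <= size s)%N -> list_sum (take h s) \in signed_sums h s.
Proof.
elim: s h => [|a s IH] [|h] //= hs.
by rewrite mem_signed_sums_cons list_sum_cons [a + _]addrC addrK IH ?orbT.
Qed.

Lemma list_sum_take_drop_signed_sums (h : nat) (s : seq int) (x : int) :
  (h.+1 <= size s)%N -> x \in take h.+1 s ->
  list_sum (take h.+1 s) - x \in signed_sums h s.
Proof.
elim: s h => // a s IH h; rewrite [take _ _]/= [size _]/= ltnS list_sum_cons in_cons => hs.
case/orP => [/eqP-> | xs].
  rewrite [a + _]addrC addrK; apply: signed_sums_consW.
  exact: list_sum_take_signed_sums.
case: h hs xs => [|h] hs xs; first by rewrite take0 in xs.
rewrite mem_signed_sums_cons; set y := list_sum _.
by rewrite (_ : a + y - x - a = y - x) ?IH ?orbT //; lia.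
Qed.

(** Both sets of sums are symmetric, so every new positive sum brings its opposite. *)
Lemma signed_sums_new (h : nat) (b : int) (s L : seq int) :
  uniq L ->
  {in L, forall x : int,
    [/\ 0 < x, x \in signed_sums h (b :: s) & x \notin signed_sums h s]} ->
  (distinct (signed_sums h s) + 2 * size L <= distinct (signed_sums h (b :: s)))%N.
Proof.
move=> L_uniq new.
have -> : (distinct (signed_sums h s) + 2 * size L)%N
    = size (undup (signed_sums h s) ++ (L ++ [seq - x | x <- L])).
  by rewrite !size_cat size_map addnn mul2n.
apply: leq_distinct.
  rewrite !cat_uniq undup_uniq L_uniq map_inj_uniq ?L_uniq ?andbT /=; last exact: oppr_inj.
  apply/andP; split.
    apply/hasPn => x; rewrite mem_cat mem_undup => /orP[/new[] // | /mapP[y /new[_ _ ynew] ->]].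
    by rewrite signed_sums_opp.
  by apply/hasPn => _ /mapP[y /new[y_gt0 _ _] ->]; apply/negP => /new[]; lia.
move=> x; rewrite !mem_cat mem_undup => /or3P[/signed_sums_consW -> // | /new[] // |].
by move=> /mapP[y /new[_ ys _] ->]; rewrite signed_sums_opp.
Qed.

Lemma sorted_with0 (s : seq int) :
  sorted >%R s -> {in s, forall x : int, 0 < x} ->
  sorted >%R (with0 s) /\ {in with0 s, forall x : int, 0 <= x}.
Proof.
move=> s_sorted s_pos; split; last first.
  by move=> x; rewrite mem_cat inE => /orP[/s_pos/ltW | /eqP->].
case: s s_sorted s_pos => // a s; rewrite /with0 /= cat_path => -> pos /=.
by rewrite andbT; apply: pos; apply: mem_last.
Qed.

Lemma scale_with0 (d : int) (s : seq int) : scale d (with0 s) = with0 (scale d s).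
Proof. by rewrite /scale /with0 map_cat /= mulr0. Qed.

Lemma gt_all (b : int) (s : seq int) :
  sorted >%R (b :: s) -> {in s, forall x : int, x < b}.
Proof.
have trans : transitive (>%R : rel int) by move=> ? ? ?; lia.
by move=> /(order_path_min trans)/allP bs x /bs.
Qed.

Definition top_sums (h : nat) (b : int) (s : seq int) : seq int :=
  [seq b + list_sum (take h s) - x | x <- take h s].

(** Since [x < b], the sum exceeds that of the [h] largest elements of [s], the maximum without
    [b]. *)
Lemma mem_top_sums (h : nat) (b y : int) (s : seq int) :
  (h <= size s)%N -> sorted >%R (b :: s) -> {in s, forall x : int, 0 <= x} ->
  y \in top_sums h b s ->
  [/\ 0 < y, y \in signed_sums h (b :: s) & y \notin signed_sums h s].
Proof.
move=> hs bs_sorted s_ge0 /mapP[x xs ->]; have xb := gt_all bs_sorted (mem_take xs).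
have sum_ge0 : 0 <= list_sum (take h s).
  by apply: list_sum_ge0 => z /mem_take; apply: s_ge0.
split; first by lia.
  case: h hs xs {sum_ge0} => [|h] hs xs; first by rewrite take0 in xs.
  rewrite mem_signed_sums_cons.
  set t := list_sum _; rewrite (_ : b + t - x - b = t - x); last by lia.
  by rewrite list_sum_take_drop_signed_sums ?orbT.
apply/negP => /(signed_sums_le (path_sorted bs_sorted) s_ge0).
by set t := list_sum _; lia.
Qed.

Lemma top_sums_uniq (h : nat) (b : int) (s : seq int) :
  sorted >%R (b :: s) -> uniq (top_sums h b s).
Proof.
move=> bs_sorted; rewrite map_inj_uniq; last by move=> x y /=; lia.
apply: take_uniq; apply: (sorted_uniq _ _ (path_sorted bs_sorted)); first by move=> ? ? ?; lia.
by move=> x; rewrite /= ltxx.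
Qed.

Lemma size_top_sums (h : nat) (b : int) (s : seq int) :
  (h <= size s)%N -> size (top_sums h b s) = h.
Proof. by move=> hs; rewrite size_map size_takel. Qed.

Lemma signed_sums_step (h : nat) (b : int) (s : seq int) :
  (h <= size s)%N -> sorted >%R (b :: s) -> {in s, forall x : int, 0 <= x} ->
  (distinct (signed_sums h s) + 2 * h <= distinct (signed_sums h (b :: s)))%N.
Proof.
move=> hs bs_sorted s_ge0; rewrite -[X in (2 * X)%N](size_top_sums b hs).
by apply: signed_sums_new; rewrite ?top_sums_uniq // => y; apply: mem_top_sums.
Qed.

Lemma signed_sums_extra_step (h : nat) (b y : int) (s : seq int) :
  (h <= size s)%N -> sorted >%R (b :: s) -> {in s, forall x : int, 0 <= x} ->
  0 < y -> y \in signed_sums h (b :: s) -> y \notin signed_sums h s ->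
  y \notin top_sums h b s ->
  (distinct (signed_sums h s) + 2 * h.+1 <= distinct (signed_sums h (b :: s)))%N.
Proof.
move=> hs bs_sorted s_ge0 y_gt0 ys ynew ytop.
have -> : h.+1 = size (y :: top_sums h b s) by rewrite /= size_top_sums.
apply: signed_sums_new; first by rewrite /= ytop top_sums_uniq.
by move=> z; rewrite in_cons => /orP[/eqP-> // | /mem_top_sums]; apply.
Qed.

(** * Extremal sets for h < n *)

Lemma sorted_countdown (n : nat) : sorted >%R (countdown n).
Proof. by elim: n => // -[|n] IH //=; apply/andP; split; [lia | apply: IH]. Qed.

Lemma countdown_pos (n : nat) : {in countdown n, forall x : int, 0 < x}.
Proof. by move=> x; rewrite mem_countdown => /andP[]. Qed.

(** For [k = n + 1] this is the bound [2hk - h(h+1) + 1], with [h * h] moved to the other side to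
    avoid subtraction in [nat]. *)
Lemma countdown_signed_card (h n : nat) :
  (3 <= h)%N -> (h <= n)%N ->
  (2 * h * n + h + 1 <= distinct (signed_sums h (with0 (countdown n))) + h * h)%N.
Proof.
move=> h3; elim: n => [|n IH]; first by lia.
rewrite leq_eqVlt => /orP[/eqP hn | hn].
  rewrite hn -[X in signed_sums X](size_countdown n.+1) distinct_signed_sums_near.
  by have := near_countdown_card (n := n.+1); lia.
have [ss s_ge0] := sorted_with0 (sorted_countdown n.+1) (@countdown_pos n.+1).
have s_ge0' : {in with0 (countdown n), forall x : int, 0 <= x}.
  by move=> x xs; apply: s_ge0; rewrite in_cons xs orbT.
have := @signed_sums_step h n.+1%:Z (with0 (countdown n)) _ ss s_ge0'.
rewrite size_with0 size_countdown => /(_ ltac:(lia)).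
rewrite -[_ :: _]/(with0 (countdown n.+1)).
by have := IH hn; lia.
Qed.

Lemma signed_sums1 (x : int) (s : seq int) : x \in s -> x \in signed_sums 1 s.
Proof.
elim: s => // a s IH; rewrite in_cons mem_signed_sums_cons => /orP[/eqP-> | /IH -> //].
by rewrite subrr signed_sums0 mem_head orbT.
Qed.

(** The smallest of the [k + 1] largest elements, [n - k], is replaced by [n - k - 1], possibly
    0. *)
Lemma countdown_top_pred (k n : nat) :
  (k < n)%N ->
  list_sum (take k.+1 (with0 (countdown n))) - 1
    \in signed_sums k.+1 (with0 (countdown n)).
Proof.
elim: n k => // n IH k; rewrite ltnS => kn.
have -> : with0 (countdown n.+1) = n.+1%:Z :: with0 (countdown n) by [].
case: k kn => [|k] kn.
  apply: signed_sums_consW; apply: signed_sums1; rewrite /= take0 /list_sum /=.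
  by rewrite mem_cat mem_countdown inE; lia.
rewrite mem_signed_sums_cons [take _ _]/= list_sum_cons; set t := list_sum _.
by rewrite (_ : _ + t - 1 - _ = t - 1) ?IH ?orbT //; lia.
Qed.

(** Cancelling [n] leaves the [k] largest elements below [n], with sum lowered by 1. *)
Lemma countdown_top_swap (k n : nat) :
  (0 < k)%N -> (k < n)%N ->
  list_sum (take k.+1 (with0 (countdown n))) - n.+1%:Z
    \in signed_sums k (with0 (countdown n)).
Proof.
case: n k => // n [//|k] _; rewrite ltnS => kn.
have -> : with0 (countdown n.+1) = n.+1%:Z :: with0 (countdown n) by [].
apply: signed_sums_consW; rewrite [take _ _]/= list_sum_cons; set t := list_sum _.
by rewrite (_ : _ + t - _ = t - 1) ?countdown_top_pred //; lia.
Qed.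

Lemma list_sum_scale (d : int) (s : seq int) : list_sum (scale d s) = d * list_sum s.
Proof.
elim: s => [|a s IH]; first by rewrite /list_sum /= mulr0.
by rewrite -[scale d _]/(d * a :: scale d s) !list_sum_cons IH mulrDr.
Qed.

Lemma signed_countdown_extend (h n : nat) (b d : int) :
  (3 <= h)%N -> (h <= n)%N -> 0 < d -> n%:Z * d < b ->
  (distinct (signed_sums h (b :: with0 (scale d (countdown n)))) + h * h
     <= 2 * h * n.+1 + h + 1)%N ->
  b = n.+1%:Z * d.
Proof.
move=> h3 hn d_gt0 ltb; have [//|bne] := eqVneq b (n.+1%:Z * d).
rewrite leqNgt -scale_with0 => /negP[].
have card := countdown_signed_card h3 hn.
set z := with0 _ in card *.
have z_le x : x \in z -> 0 <= x <= n%:Z by rewrite mem_cat mem_countdown inE; lia.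
have [z_sorted _] := sorted_with0 (sorted_countdown n) (@countdown_pos n).
have s_le x : x \in scale d z -> 0 <= x < b by move=> /mapP[y /z_le yn ->]; nia.
have s_sorted : sorted >%R (scale d z).
  by rewrite sorted_map; apply: sub_sorted z_sorted => x y /= xy; rewrite ltr_pM2l.
have bs_sorted : sorted >%R (b :: scale d z).
  by rewrite /= path_min_sorted //; apply/allP => x /s_le /andP[].
have s_ge0 : {in scale d z, forall x : int, 0 <= x} by move=> x /s_le /andP[].
have z_size : size z = n.+1 by rewrite size_with0 size_countdown.
have hs : (h <= size (scale d z))%N by rewrite size_map z_size; lia.
have sumE : list_sum (take h (scale d z)) = d * list_sum (take h z).
  by rewrite -map_take list_sum_scale.
(* The sums in [top_sums] are [b + d * (t - w)] with [w <= n]; the extra sum [y] takes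
   [w = n + 1]. *)
pose t := list_sum (take h z); pose y := b + d * (t - n.+1%:Z).
have tz : t - n.+1%:Z \in signed_sums h.-1 z.
  by rewrite /t; case: (h) h3 hn => [//|k] h3 hn; apply: countdown_top_swap; lia.
have t_ge : n%:Z <= t.
  rewrite /t /z; case: (h) (n) h3 hn => [//|k] [//|m] _ _.
  rewrite [take _ _]/= list_sum_cons lerDl; apply: list_sum_ge0 => x /mem_take.
  by rewrite mem_cat mem_countdown inE; lia.
have y_gt0 : 0 < y by rewrite /y; nia.
have extra := @signed_sums_extra_step h b y (scale d z) hs bs_sorted s_ge0 y_gt0.
suff : (distinct (signed_sums h (scale d z)) + 2 * h.+1
          <= distinct (signed_sums h (b :: scale d z)))%N.
  by rewrite {1}signed_sums_scale distinct_scale ?gt_eqF //; lia.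
apply: extra.
- case: (h) h3 tz => [//|k] _ tz; rewrite mem_signed_sums_cons /y.
  by rewrite [b + _]addrC addrK !signed_sums_scale (mem_scale _ tz) orbT.
(* If [b] is above [(n + 1) * d], then [y] exceeds the maximum [d * t]; if below, neither [b] nor
   [y] is a multiple of [d]. *)
- have [bgt|blt] := ltP (n.+1%:Z * d) b.
    apply/negP => /(signed_sums_le s_sorted s_ge0); rewrite sumE -/t /y; nia.
  rewrite signed_sums_scale; apply/negP => /mapP[j _ yE].
  have {}bE : b = d * (j - (t - n.+1%:Z)) by move: yE; rewrite /y; lia.
  move: bne blt ltb; rewrite bE ![_ * d]mulrC => bne blt.
  rewrite ltr_pM2l // => ltb; move: blt; rewrite ler_pM2l // => blt.
  by case/eqP: bne; congr (_ * _); lia.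
- apply/negP => /mapP[x]; rewrite -map_take => /mapP[w /mem_take/z_le wn ->].
  rewrite -/(scale _ _) list_sum_scale -/t /y => E.
  have : d * (n.+1%:Z - w) = 0 by lia.
  by nia.
Qed.

(** The sums [b + d * j] are new because they exceed the maximum without [b]. This excludes
    extensions of the two exceptional sets. *)
Lemma signed_sums_shifted (h : nat) (b d : int) (z J : seq int) :
  0 < d -> sorted >%R z -> all (fun x => 0 <= x) z -> sorted <%R J ->
  all (fun j => j \in signed_sums h z) J ->
  all (fun j => d * list_sum (take h.+1 z) < b + d * j) J ->
  (distinct (signed_sums h.+1 z) + 2 * size J
     <= distinct (signed_sums h.+1 (b :: scale d z)))%N.
Proof.
move=> d_gt0 z_sorted /allP z_ge0 /lt_sorted_uniq J_uniq /allP Jz /allP Jgt.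
rewrite -(@distinct_scale d) ?gt_eqF // -signed_sums_scale -(size_map (fun j => b + d * j)).
apply: signed_sums_new.
  by rewrite map_inj_uniq // => i j /addrI /mulfI; apply; lia.
move=> _ /mapP[j jJ ->]; have jgt := Jgt j jJ; split.
- apply: le_lt_trans jgt; rewrite mulr_ge0 ?(ltW d_gt0) //.
  by apply: list_sum_ge0 => x /mem_take/z_ge0.
- rewrite mem_signed_sums_cons [b + _]addrC addrK !signed_sums_scale.
  by rewrite (mem_scale _ (Jz j jJ)) orbT.
- rewrite signed_sums_scale; apply/negP => /mapP[y /(signed_sums_le z_sorted z_ge0) yz yE].
  by move: jgt; rewrite yE ltr_pM2l //; lia.
Qed.

Definition signed_extremal (h : nat) (s : seq int) : Prop :=
  exists2 d : int, 0 < d &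
    [\/ s = scale d (countdown (size s)),
        [/\ h = 3%N, size s = 3%N & s = scale d [:: 4; 2; 1]]
      | [/\ h = 4%N, size s = 4%N & s = scale d [:: 6; 4; 2; 1]]].

(** Induction down to [size s = h], where [near_even_sums_inverse] applies. *)
Lemma signed_sums_inverse (h : nat) (s : seq int) :
  sorted >%R s -> {in s, forall x : int, 0 < x} -> (3 <= h)%N -> (h <= size s)%N ->
  (distinct (signed_sums h (with0 s)) + h * h <= 2 * h * size s + h + 1)%N ->
  signed_extremal h s.
Proof.
move=> + + h3; elim: s => [|b s IH] s_sorted s_pos; first by rewrite leqn0; lia.
rewrite leq_eqVlt => /orP[/eqP hE | hs] le.
  have [||d d_gt0 [sE|[s3 sE]|[s4 sE]]] := near_even_sums_inverse s_sorted s_pos.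
  - by rewrite -hE; lia.
  - by move: le; rewrite -distinct_signed_sums_near -hE; lia.
  - by exists d => //; constructor 1.
  - by exists d => //; constructor 2; rewrite hE.
  - by exists d => //; constructor 3; rewrite hE.
have [t_sorted t_uniq t_pos t_lt] := sorted_gt_cons s_sorted s_pos.
have [bs_sorted bs_ge0] := sorted_with0 s_sorted s_pos.
have [ss_sorted ss_ge0] := sorted_with0 t_sorted t_pos.
rewrite /= ltnS in hs.
have hs0 : (h <= size (with0 s))%N by rewrite size_with0; lia.
have := signed_sums_step hs0 bs_sorted ss_ge0; rewrite -[_ :: _]/(with0 (b :: s)) => step.
have [|d d_gt0] := IH t_sorted t_pos hs; first by move: le; rewrite /=; lia.
have head_lt (x : int) t : s = scale d t -> x \in t -> x * d < b.
  move=> sE xt; have xs : d * x \in s by rewrite sE mem_scale.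
  by have := t_lt _ xs; lia.
case=> [sE | [hE s3 sE] | [hE s4 sE]].
- exists d => //; constructor 1; rewrite -[size _]/(size s).+1 /=.
  rewrite /scale /= -/(scale d _) -sE; congr (_ :: _); rewrite mulrC.
  apply: (@signed_countdown_extend h (size s)) => //; rewrite -?sE //.
  by apply: (head_lt (size s)%:Z _ sE); rewrite mem_countdown; lia.
(* At most 19 sums are allowed, but the four values [j] give at least [12 + 2 * 4]. *)
- have b4 := head_lt 4 _ sE isT; pose z : seq int := with0 [:: 4; 2; 1].
  have := @signed_sums_shifted 2 b d z [:: 3; 4; 5; 6] d_gt0 isT isT isT isT.
  have -> : list_sum (take 3 z) = 7 by [].
  have card : (12 <= distinct (signed_sums 3 z))%N by vm_compute.
  rewrite scale_with0 -sE -with0_cons => /(_ ltac:(rewrite /=; lia)) /=.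
  by move: le; rewrite hE /= s3 => *; exfalso; lia.
(* At most 29 sums are allowed, but the five values [j] give at least [21 + 2 * 5]. *)
have b6 := head_lt 6 _ sE isT; pose z : seq int := with0 [:: 6; 4; 2; 1].
have := @signed_sums_shifted 3 b d z [:: 7; 8; 9; 11; 12] d_gt0 isT isT isT isT.
have -> : list_sum (take 4 z) = 13 by [].
have card : (21 <= distinct (signed_sums 4 z))%N by vm_compute.
rewrite scale_with0 -sE -with0_cons => /(_ ltac:(rewrite /=; lia)) /=.
by move: le; rewrite hE /= s4 => *; exfalso; lia.
Qed.

(** * Restricted signed sumsets of finite sets *)

Lemma mem_signs (x : int) : (x \in signs) = [|| x == -1, x == 0 | x == 1].
Proof. by rewrite !inE orbA. Qed.

Lemma signed_sumsP (h : nat) (t : seq int) (x : int) :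
  uniq t ->
  x \in signed_sums h t <->
  exists lam : int -> int,
    [/\ forall a, a \in t -> lam a \in signs,
        \sum_(a <- t) `|lam a| = h%:Z & x = \sum_(a <- t) lam a * a].
Proof.
move=> t_uniq; split.
  elim: t h x t_uniq => [|a t IH] h x.
    case: h => // _; rewrite inE => /eqP->.
    by exists (fun=> 0); split; rewrite ?big_nil.
  move=> /= /andP[at_ t_uniq].
  have extend e g y : e \in signs -> y \in signed_sums g t ->
      exists lam : int -> int,
        [/\ forall c, c \in a :: t -> lam c \in signs,
            \sum_(c <- a :: t) `|lam c| = `|e| + g%:Z
          & e * a + y = \sum_(c <- a :: t) lam c * c].
    move=> es /(IH _ _ t_uniq)[lam [lamP lam_h ->]].
    have neq c : c \in t -> (c == a) = false.
      by move=> ct; apply: contraNF at_ => /eqP <-.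
    exists (fun c => if c == a then e else lam c); split.
    - by move=> c; rewrite in_cons; case: eqP => //= _ /lamP.
    - rewrite big_cons eqxx -lam_h; congr (_ + _).
      by apply: eq_big_seq => c /neq ->.
    - rewrite big_cons eqxx; congr (_ + _).
      by apply: eq_big_seq => c /neq ->.
  case: h => [|h].
    rewrite signed_sums0 inE => /eqP->.
    have := @extend 0 0%N 0; rewrite mem_signs signed_sums0.
    move=> /(_ isT (mem_head _ _))[lam [lamP lam_h lamE]].
    by exists lam; split=> //; rewrite -lamE mul0r.
  rewrite mem_signed_sums_cons => /or3P[] /extend ext.
  - have [|lam [lamP lam_h lamE]] := ext 0; first by rewrite mem_signs.
    by exists lam; split=> //; rewrite -lamE mul0r add0r.
  - have [|lam [lamP lam_h lamE]] := ext 1; first by rewrite mem_signs.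
    by exists lam; split=> //; rewrite ?lam_h -?lamE; lia.
  - have [|lam [lamP lam_h lamE]] := ext (-1); first by rewrite mem_signs.
    by exists lam; split=> //; rewrite ?lam_h -?lamE; lia.
case=> lam []; elim: t h x {t_uniq} => [|a t IH] h x lamP.
  by rewrite !big_nil => h0 ->; rewrite (_ : h = 0%N) //; lia.
rewrite !big_cons => lam_h ->.
have {}IH := IH _ _ (fun c ct => lamP c (@mem_behead _ (a :: t) c ct)).
have sum_ge0 : 0 <= \sum_(c <- t) `|lam c| by apply: sumr_ge0.
have [p pE] : exists p : nat, \sum_(c <- t) `|lam c| = p%:Z.
  by exists (absz (\sum_(c <- t) `|lam c|)); rewrite gez0_abs.
have := lamP a (mem_head _ _); rewrite mem_signs => /or3P[] /eqP ae.
- have hE : h = p.+1 by move: lam_h; rewrite pE ae; lia.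
  by rewrite hE mem_signed_sums_cons ae mulN1r [- a + _]addrC subrK (IH p _ pE erefl) !orbT.
- have hE : h = p by move: lam_h; rewrite pE ae; lia.
  by rewrite ae mul0r add0r hE; apply: signed_sums_consW; apply: (IH p _ pE erefl).
- have hE : h = p.+1 by move: lam_h; rewrite pE ae; lia.
  by rewrite hE mem_signed_sums_cons ae mul1r [a + _]addrC addrK (IH p _ pE erefl) !orbT.
Qed.

Lemma signed_sums_perm (h : nat) (t u : seq int) :
  uniq t -> perm_eq t u -> signed_sums h t =i signed_sums h u.
Proof.
move=> t_uniq tu x; have u_uniq : uniq u by rewrite -(perm_uniq tu).
suff incl v w : uniq v -> uniq w -> perm_eq v w ->
    x \in signed_sums h v -> x \in signed_sums h w.
  by apply/idP/idP; apply: incl; rewrite // perm_sym.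
move=> v_uniq w_uniq vw /(signed_sumsP _ _ v_uniq)[lam [lamP lam_h xE]].
apply/(signed_sumsP _ _ w_uniq); exists lam; split.
- by move=> a; rewrite -(perm_mem vw); apply: lamP.
- by rewrite -lam_h; apply/esym/perm_big.
- by rewrite xE; apply/perm_big.
Qed.

(** Changing the sign of an element exchanges its two signed branches. *)
Lemma signed_sums_norm (h : nat) (t : seq int) :
  signed_sums h [seq `|a| | a <- t] =i signed_sums h t.
Proof.
elim: t h => [|a t IH] [|h] x //.
rewrite !mem_signed_sums_cons !IH; case: (ger0P a) => // _.
by rewrite opprK; congr (_ || _); rewrite orbC.
Qed.

Lemma restricted_signed_sumset_norm (h : nat) (A : {fset int}) (t : seq int) :
  {in A &, injective (fun a : int => `|a|)} ->
  perm_eq [seq `|a| | a <- A] t ->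
  #|` restricted_signed_sumset h A| = distinct (signed_sums h t).
Proof.
move=> A_inj At; apply/perm_size/uniq_perm; rewrite ?fset_uniq ?undup_uniq // => x.
rewrite mem_undup -(signed_sums_perm h _ At) ?map_inj_in_uniq ?fset_uniq // signed_sums_norm.
apply/idP/idP => [/restricted_signed_sumsetP | /signed_sumsP].
  by move=> xP; apply/(signed_sumsP _ _ (fset_uniq A)).
by move=> /(_ (fset_uniq A)) xP; apply/restricted_signed_sumsetP.
Qed.

Theorem theorem1p4 (h k : nat) (A : {fset int}) (d : int)
    (h_ge3 : (3 <= h)%N) (h_le : (h <= k - 1)%N) (k_ge5 : (5 <= k)%N)
    (A_card : #|` A| = k)
    (A_opp : A `&` opp_set A = [fset 0])
    (A_sumset : #|` restricted_signed_sumset h A|%:Z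
                = 2 * h%:Z * k%:Z - h%:Z * (h%:Z + 1) + 1)
    (d_min : is_smallest_nonzero d (abs_set A)) :
  (h = 4%N /\ k = 5%N ->
     abs_set A = dilate d (int_interval 0 4)
     \/ abs_set A = dilate d [fset 0; 1; 2; 4; 6])
  /\ (~ (h = 4%N /\ k = 5%N) ->
     abs_set A = dilate d (int_interval 0 (k%:Z - 1))).
Proof.
have A_abs_inj : {in A &, injective (fun a : int => `|a|)}.
  move=> x y xA yA xy; have [//|xy_opp] : x = y \/ x = - y by lia.
  have : x \in A `&` opp_set A.
    by rewrite in_fsetI xA; apply/imfsetP; exists y.
  by rewrite A_opp inE => /eqP; lia.
have A0 : 0 \in A.
  by have : 0 \in A `&` opp_set A; [rewrite A_opp inE | rewrite in_fsetI => /andP[]].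
pose T : seq int := [seq `|a| | a <- A].
have T_uniq : uniq T by rewrite map_inj_in_uniq ?fset_uniq.
have memT : abs_set A =i T.
  by move=> x; apply/imfsetP/mapP => -[a aA ->]; exists a.
have T0 : 0 \in T by apply/mapP; exists 0; rewrite ?normr0.
(* The nonzero absolute values in decreasing order, so that [with0 s] enumerates [abs_set A]. *)
pose s : seq int := rev (sort <=%O (rem 0 T)).
have s_perm : perm_eq s (rem 0 T) by rewrite perm_rev perm_sort.
have Ts : perm_eq T (with0 s).
  apply: perm_trans (perm_to_rem T0) _.
  by rewrite perm_sym /with0 perm_catC /= perm_cons.
have s_sorted : sorted >%R s by rewrite rev_sorted sort_lt_sorted rem_uniq.
have s_pos : {in s, forall x : int, 0 < x}.
  move=> x; rewrite (perm_mem s_perm) mem_rem_uniq // inE => /andP[x0 /mapP[a _ xE]].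
  by move: x0; rewrite xE normr_eq0 normr_gt0.
have s_size : k = (size s).+1.
  by rewrite -size_with0 -(perm_size Ts) size_map -A_card.
rewrite (restricted_signed_sumset_norm h A_abs_inj Ts) in A_sumset.
have [||e e_gt0 sE] := @signed_sums_inverse h s s_sorted s_pos h_ge3.
- by lia.
- by move: A_sumset; rewrite s_size; lia.
have A_abs t : s = scale e t -> abs_set A =i scale e (with0 t).
  by move=> stE x; rewrite memT (perm_mem Ts) stE scale_with0.
(* As 1 is in [t], [e] is a nonzero absolute value, hence [d <= e]; conversely [d] is a positive
   multiple of [e]. *)
have de t : s = scale e t -> 1 \in t -> {in t, forall x : int, 0 < x} -> d = e.
  case: d_min => dA d0 d_le stE t1 t_pos.
  have de : d <= e.
    apply: d_le; rewrite ?gt_eqF // (A_abs t) // -{1}[e]mulr1 mem_scale //.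
    by rewrite mem_cat t1.
  move: dA; rewrite (A_abs t) // => /mapP[x xt dE]; move: d0 de; rewrite dE.
  rewrite mem_cat inE in xt; case/orP: xt => [/t_pos|/eqP->]; last by rewrite mulr0 eqxx.
  by nia.
have finish t S : s = scale e t -> 1 \in t -> {in t, forall x : int, 0 < x} ->
    (forall x, x \in with0 t = (x \in S)) -> abs_set A = dilate d S.
  move=> stE t1 t_pos tS; apply/fsetP => x; rewrite (A_abs t) // (de t) //.
  by apply/mapP/imfsetP => -[y yt ->]; exists y; rewrite // ?tS // -tS.
have interval : s = scale e (countdown (size s)) ->
    abs_set A = dilate d (int_interval 0 (k%:Z - 1)).
  move=> stE; apply: (finish _ _ stE); rewrite ?mem_countdown; first by lia.
    exact: countdown_pos.
  by move=> x; rewrite mem_cat mem_countdown inE mem_int_interval s_size; lia.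
case: sE => [stE | [hE s3 stE] | [hE s4 stE]].
- split=> [[hE kE] | _]; last exact: interval.
  by left; have := interval stE; rewrite kE.
- by move: k_ge5; rewrite s_size s3.
- split=> [_ | []]; last by rewrite s_size s4.
  right; apply: (finish _ _ stE) => //; first by apply/allP.
  by move=> x; rewrite !inE; lia.
Qed.
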